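(* Let $d\ge1$, $G=\mathrm{SO}^\circ(d+1,1)$, and let $\mathcal U(\upsilon,s)$ ($\upsilon\in\hat M$, $s\in\mathcal I_\upsilon$) be a complementary series representation of $G$. If $\upsilon\in\hat M$ is non-trivial, then for any $K$-types $\tau_1,\tau_2$ of $\mathcal U(\upsilon,s)$ and any $M$-invariant $v\in\mathcal U(\upsilon,s)_{\tau_1}$, $$T_{\tau_1}^{\tau_2}v=0.$$
   Context: Groups: $K\simeq\mathrm{SO}(d+1)$ is a maximal compact subgroup of $G$, $A=\{a_t\}$ a one-parameter diagonalizable subgroup, $M\simeq\mathrm{SO}(d)$ the centralizer of $A$ in $K$, $N=\{g:a_{-t}ga_t\to e,\ t\to+\infty\}$, with $a_t$ normalized so that $\mathrm{Ad}(a_t)$ is $e^t\,\mathrm{Id}$ on $\mathrm{Lie}(N)$. Iwasawa decomposition $G=KAN$: $g=\kappa(g)\,a_{H(g)}\,n_g$ with $\kappa(g)\in K$, $H(g)\in\mathbb R$, $n_g\in N$. $dm$ is the Haar probability measure on $M$. Representations: for $s\in\mathbb C$, $G$ acts on $L^2(K)$ by $[U^s(g)v](k)=e^{-sH(g^{-1}k)}v(\kappa(g^{-1}k))$; $U^s|_K$ is left translation. For $\upsilon\in\hat M$, $L^2(K:\upsilon)=\{v\in L^2(K):\int_M\overline{\chi_\upsilon(m)}\,v(\cdot\, m)\,dm=v\}$, $\chi_\upsilon=\dim(\upsilon)\mathrm{tr}\,\upsilon$. By Hirai's classification, for each $\upsilon$ there is a (possibly empty) interval $\mathcal I_\upsilon\subset(\frac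 d2,d)$ such that for $s\in\mathcal I_\upsilon$ there is an irreducible, unitarizable subrepresentation $\mathcal U(\upsilon,s)$ of $(U^s,L^2(K:\upsilon))$; these are the complementary series. Each $\tau\in\hat K$ whose restriction to $M$ contains $\upsilon$ occurs exactly once in $\mathcal U(\upsilon,s)$, and no other $K$-type occurs. $\mathcal U(\upsilon,s)_\tau$ (a finite-dimensional space of continuous functions on $K$) is the $K$-type $\tau$. ''$M$-invariant'' means invariant under $U^s(m)$ for all $m\in M$. Operators: $\langle\cdot,\cdot\rangle_K$ is the inner product of $L^2(K)$. For a $K$-type $\tau$ of $\mathcal U(\upsilon,s)$, $\chi_\tau:=\sum_{i=1}^{\dim\tau}\overline{v_i(e)}\,v_i\in\mathcal U(\upsilon,s)_\tau$, where $\{v_i\}$ is a $\langle\cdot,\cdot\rangle_K$-orthonormal basis of $\mathcal U(\upsilon,s)_\tau$. Define $T_{\tau_1}^{\tau_2}:\mathcal U(\upsilon,s)_{\tau_1}\to\mathcal U(\upsilon,s)_{\tau_2}$ by $T_{\tau_1}^{\tau_2}v=\int_Mv(m)\,U^s(m)\chi_{\tau_2}\,dm$. *)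

(* Defs.v *)
From HB Require Import structures.
From mathcomp Require Import all_boot all_order all_algebra.
From mathcomp Require Import complex.
From mathcomp Require Import all_classical all_reals all_analysis.
Set Implicit Arguments.
Unset Strict Implicit.
Unset Printing Implicit Defensive.
Import Order.TTheory GRing.Theory Num.Theory.
Import numFieldNormedType.Exports.
Local Open Scope classical_set_scope.
Local Open Scope ring_scope.
Local Open Scope complex_scope.

Section MatrixGroups.
Variable R : realType.

Definition SO n : set 'M[R]_n := [set g | g^T *m g = 1%:M /\ \det g = 1].
Arguments SO n : clear implicits.

Definition lorentz n : 'M[R]_(n.+1) :=
  diag_mx (\row_j (if j == ord_max then -1 else 1)).

Definition SO1 n : set 'M[R]_(n.+1) :=
  [set g | g^T *m lorentz n *m g = lorentz n /\ \det g = 1].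
Arguments SO1 n : clear implicits.

Definition SO1o n : set 'M[R]_(n.+1) := connected_component (SO1 n) 1%:M.
Arguments SO1o n : clear implicits.

Definition subgroup n (S G : set 'M[R]_n) : Prop :=
  [/\ S `<=` G, S 1%:M, (forall g h, S g -> S h -> S (g *m h)) &
      (forall g, S g -> S (invmx g))].

(* isomorphism of topological groups *)
Definition top_isomorphic n p (S : set 'M[R]_n) (T : set 'M[R]_p) : Prop :=
  exists (f : 'M[R]_n -> 'M[R]_p) (f' : 'M[R]_p -> 'M[R]_n),
    [/\ (forall g, S g -> T (f g) /\ f' (f g) = g),
        (forall h, T h -> S (f' h) /\ f (f' h) = h),
        (forall g g', S g -> S g' -> f (g *m g') = f g *m f g'),
        {within S, continuous f} & {within T, continuous f'}].

Definition maximal_compact_subgroup n (K G : set 'M[R]_n) : Prop :=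
  [/\ subgroup K G, compact K &
      forall L, subgroup L G -> compact L -> K `<=` L -> L = K].

(* The subgroup is diagonalizable over R, by one change of basis for all t. *)
Definition diagonalizable_one_parameter n (a : R -> 'M[R]_n) (G : set 'M[R]_n)
  : Prop :=
  [/\ (forall t, G (a t)), (forall t u, a (t + u) = a t *m a u),
      continuous a &
      exists2 P, P \in unitmx & forall t, diagonalizable_for P (a t)].

Definition centralizer n (a : R -> 'M[R]_n) (K : set 'M[R]_n) : set 'M[R]_n :=
  [set k | K k /\ forall t, k *m a t = a t *m k].

Definition horospherical n (a : R -> 'M[R]_n) (G : set 'M[R]_n) : set 'M[R]_n :=
  [set g | G g /\ a (- t) *m g *m a t @[t --> +oo] --> (1%:M : 'M[R]_n)].

(* The Lie algebra of a closed linear group, as its tangent space at 1. *)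
Definition Lie n (S : set 'M[R]_(n.+1)) : set 'M[R]_(n.+1) :=
  [set X | exists c : R -> 'M[R]_(n.+1),
     [/\ c 0 = 1%:M, (forall t, S (c t)) & is_derive (0 : R) (1 : R) c X]].

Definition borel n := g_sigma_algebraType (@open 'M[R]_n).

Definition haar_probability n (S : set 'M[R]_n) (mu : probability (borel n) R)
  : Prop :=
  mu S = 1%E /\
  forall (g : 'M[R]_n) (B : set (borel n)), S g -> measurable B ->
    mu ((fun h : 'M[R]_n => g *m h) @` B) = mu B.

End MatrixGroups.
Arguments SO R n : clear implicits.
Arguments SO1o R n : clear implicits.
Arguments borel R n : clear implicits.

(* The group SO°(d+1,1) with the choices fixed throughout: K, A = {a_t}, the
   Iwasawa maps kappa and H, and the Haar probability measures of K and M
   (as Borel measures on the space of matrices carried by K and M). *)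
Record iwasawa_data (R : realType) (d : nat) := IwasawaData {
  Kgrp : set 'M[R]_(d.+2) ;
  Kgrp_max : maximal_compact_subgroup Kgrp (SO1o R d.+1) ;
  Kgrp_iso : top_isomorphic Kgrp (SO R d.+1) ;
  aflow : R -> 'M[R]_(d.+2) ;
  aflow_diag : diagonalizable_one_parameter aflow (SO1o R d.+1) ;
  Mgrp_iso : top_isomorphic (centralizer aflow Kgrp) (SO R d) ;
  aflow_normalized : forall t X, Lie (horospherical aflow (SO1o R d.+1)) X ->
    aflow t *m X *m invmx (aflow t) = expR t *: X ;
  kappa : 'M[R]_(d.+2) -> 'M[R]_(d.+2) ;
  Hproj : 'M[R]_(d.+2) -> R ;
  iwasawa_exists : forall g, SO1o R d.+1 g ->
    Kgrp (kappa g) /\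
    exists2 n, horospherical aflow (SO1o R d.+1) n &
      g = kappa g *m aflow (Hproj g) *m n ;
  iwasawa_unique : forall k t n,
    Kgrp k -> horospherical aflow (SO1o R d.+1) n ->
    kappa (k *m aflow t *m n) = k /\ Hproj (k *m aflow t *m n) = t ;
  muK : probability (borel R d.+2) R ;
  muK_haar : haar_probability Kgrp muK ;
  muM : probability (borel R d.+2) R ;
  muM_haar : haar_probability (centralizer aflow Kgrp) muM }.

Section Representations.
Variables (R : realType) (d : nat) (X : iwasawa_data R d).

Local Notation C := R[i].
Local Notation mat := 'M[R]_(d.+2).
Local Notation G := (SO1o R d.+1).
Local Notation K := (Kgrp X).

Definition Mgrp : set mat := centralizer (aflow X) K.
Local Notation M := Mgrp.

Definition Cintegral (mu : probability (borel R d.+2) R) (D : set mat)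
    (f : mat -> C) : C :=
  (\int[mu]_(x in D) complex.Re (f x)) +i* (\int[mu]_(x in D) complex.Im (f x)).

Definition cexp (z : C) : C :=
  (expR (complex.Re z))%:C *
  ((cos (complex.Im z)) +i* (sin (complex.Im z))).

(* Functions on K are represented by functions on matrices; only their values
   on K are ever used.  Elements of L^2(K) are represented by functions, and
   subspaces of L^2(K) by sets of functions; the closed ones contain, with v,
   every function equal to v almost everywhere on K. *)

Definition sqnormK (v : mat -> C) : \bar R :=
  (\int[muK X]_(x in K)
     (complex.Re (v x) ^+ 2 + complex.Im (v x) ^+ 2)%:E)%E.

Definition L2K : set (mat -> C) :=
  [set v | [/\ measurable_fun (K : set (borel R d.+2))
                 (fun x => complex.Re (v x)),
               measurable_fun (K : set (borel R d.+2))
                 (fun x => complex.Im (v x)) &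
               (sqnormK v < +oo)%E]].

Definition dotK (v w : mat -> C) : C :=
  Cintegral (muK X) K (fun k => v k * (w k)^*).

Definition U (s : C) (g : mat) (v : mat -> C) : mat -> C :=
  fun k => cexp (- (s * (Hproj X (invmx g *m k))%:C)) *
           v (kappa X (invmx g *m k)).

(* rho acts on column vectors; the row space of W encodes a subspace. *)
Definition irreducible_unitary (S : set mat) n (rho : mat -> 'M[C]_n) : Prop :=
  [/\ (0 < n)%N,
      (forall g h, S g -> S h -> rho (g *m h) = rho g *m rho h),
      (forall g, S g -> rho g \is unitarymx),
      (forall i j, {within S, continuous (fun g => rho g i j : C^o)}) &
      (forall W : 'M[C]_n, (forall g, S g -> (W *m (rho g)^T <= W)%MS) ->
         W = 0 \/ row_full W)].

Definition trivial_on (S : set mat) n (rho : mat -> 'M[C]_n) : Prop :=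
  forall g, S g -> rho g = 1%:M.

Definition chi_rep n (rho : mat -> 'M[C]_n) (g : mat) : C := n%:R * \tr (rho g).

(* L^2(K : upsilon) *)
Definition L2K_type n (ups : mat -> 'M[C]_n) : set (mat -> C) :=
  [set v | L2K v /\
     {ae muK X, forall k, K k ->
        Cintegral (muM X) M (fun m => (chi_rep ups m)^* * v (k *m m)) = v k}].

Definition closed_subspace (V : set (mat -> C)) : Prop :=
  [/\ V `<=` L2K, V (fun=> 0),
      (forall (c : C) v w, V v -> V w -> V (fun x => c * v x + w x)) &
      (forall v, L2K v ->
         (forall e : R, 0 < e ->
            exists2 w, V w & (sqnormK (fun x => (v x - w x)%R) < e%:E)%E) ->
         V v)].

Definition U_invariant (s : C) (V : set (mat -> C)) : Prop :=
  forall g v, G g -> V v -> V (U s g v).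

Definition U_irreducible (s : C) (V : set (mat -> C)) : Prop :=
  (exists2 v, V v & sqnormK v != 0%E) /\
  forall W, closed_subspace W -> U_invariant s W -> W `<=` V ->
    W = V \/ (forall w, W w -> sqnormK w = 0%E).

(* existence of an invariant inner product, continuous for the L^2 norm (so
   that the completed representation is strongly continuous) *)
Definition unitarizable (s : C) (V : set (mat -> C)) : Prop :=
  exists B : (mat -> C) -> (mat -> C) -> C,
    [/\ (forall (c : C) u v w, V u -> V v -> V w ->
           B (fun x => c * u x + v x) w = c * B u w + B v w),
        (forall v w, V v -> V w -> B v w = (B w v)^*),
        (forall v, V v -> 0 <= B v v /\ (B v v = 0 -> sqnormK v = 0%E)),
        (exists c : R, forall v, V v -> B v v <= (c * fine (sqnormK v))%:C) &
        (forall g v w, G g -> V v -> V w -> B (U s g v) (U s g w) = B v w)].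

(* The tau-isotypic part V_tau, through its continuous representatives: as for
   L^2(K : upsilon), the projector is the convolution with the conjugate of
   chi_tau, here for the left action U^s|_K. *)
Definition isotypic (s : C) (V : set (mat -> C)) n (tau : mat -> 'M[C]_n)
  : set (mat -> C) :=
  [set v | [/\ {within K, continuous (v : mat -> C^o)}, V v &
     forall x, K x ->
       Cintegral (muK X) K (fun k => (chi_rep tau k)^* * U s k v x) = v x]].

Definition occurs (s : C) (V : set (mat -> C)) n (tau : mat -> 'M[C]_n) : Prop :=
  exists2 v, isotypic s V tau v & exists2 x, K x & v x != 0.

Definition Ktype (s : C) (V : set (mat -> C)) n (tau : mat -> 'M[C]_n) : Prop :=
  irreducible_unitary K tau /\ occurs s V tau.

Definition orthonormal_basis n (e : 'I_n -> mat -> C) (E : set (mat -> C))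
  : Prop :=
  [/\ (forall i, E (e i)),
      (forall i j, dotK (e i) (e j) = (i == j)%:R) &
      (forall v, E v -> exists c : 'I_n -> C,
         forall x, K x -> v x = \sum_(i < n) c i * e i x)].

Definition restriction_contains p (tau : mat -> 'M[C]_p) n (ups : mat -> 'M[C]_n)
  : Prop :=
  exists2 B : 'M[C]_(p, n), B != 0 & forall m, M m -> tau m *m B = B *m ups m.

(* V is a realization of the complementary series U(upsilon, s); the parameter
   interval of upsilon consists of the s for which there is such a V.  Given
   the irreducibility of tau, tau occurs exactly once in V when dim V_tau is
   dim tau. *)
Definition complementary_series n (ups : mat -> 'M[C]_n) (s : R)
    (V : set (mat -> C)) : Prop :=
  [/\ irreducible_unitary M ups,
      d%:R / 2 < s < d%:R,
      [/\ closed_subspace V, V `<=` L2K_type ups & U_invariant s%:C V],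
      U_irreducible s%:C V /\ unitarizable s%:C V &
      forall p (tau : mat -> 'M[C]_p), irreducible_unitary K tau ->
        (restriction_contains tau ups ->
           exists e : 'I_p -> mat -> C,
             orthonormal_basis e (isotypic s%:C V tau)) /\
        (occurs s%:C V tau -> restriction_contains tau ups)].

Definition Minvariant (s : C) (v : mat -> C) : Prop :=
  forall m, M m -> forall k, K k -> U s m v k = v k.

(* chi_tau, from an orthonormal basis e of V_tau *)
Definition chi_vec n (e : 'I_n -> mat -> C) : mat -> C :=
  fun k => \sum_(i < n) (e i 1%:M)^* * e i k.

(* T_{tau1}^{tau2} v, with e an orthonormal basis of V_{tau2}; the integral in
   the finite-dimensional function space V_{tau2} is taken pointwise. *)
Definition Top (s : C) n (e : 'I_n -> mat -> C) (v : mat -> C) : mat -> C :=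
  fun k => Cintegral (muM X) M (fun m => v m * U s m (chi_vec e) k).

End Representations.

(* Main.v *)
Require Import Defs.
From HB Require Import structures.
From mathcomp Require Import all_boot all_order all_algebra.
From mathcomp Require Import complex finmap.
From mathcomp Require Import all_classical all_reals all_analysis.
From mathcomp Require Import measurable_realfun.
Set Implicit Arguments.
Unset Strict Implicit.
Unset Printing Implicit Defensive.
Import Order.TTheory GRing.Theory Num.Theory.
Import numFieldNormedType.Exports.
Local Open Scope classical_set_scope.
Local Open Scope ring_scope.
Local Open Scope complex_scope.

(** The integrand of [Top] carries the factor [v m] with [m] in [M], and this
    factor vanishes identically.

    On [K] the operators [U s] are left translations, so an [M]-invariant [v]
    satisfies [v m = v 1] for every [m] in [M] ([Minvariant_cst]).  On the other
    hand [v] belongs to [L2K_type], that is,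
    [v k] is the integral of [(chi_rep ups m)^* * v (k *m m)] over [M], for
    almost every [k] in [K].  As [v] is continuous and Haar measure charges every
    neighbourhood of the identity, this identity holds at [k = 1]
    ([L2K_type_at1]).  There it reads [v 1 = v 1 * I], with [I] the
    integral over [M] of the conjugate of the character of [ups], and [I = 0]
    because [ups] is irreducible and non-trivial ([Cintegral_conj_chi_eq0]).
    Hence [v] vanishes at [1], and so on all of [M].

    The analytic input consists of three properties of the Haar probability
    measure of a compact matrix group: invariance of integrals under left
    translation ([haar_Rintegral]), positivity near the identity
    ([haar_charges_nbhs1]) and bounded convergence
    ([bounded_Cintegral_cvg]). *)

(** * Continuity of complex-valued and matrix-valued maps *)

Section Cont.
Variable R : realType.
Local Notation C := R[i].

Lemma normc_ge_Im (x : C) : `|complex.Im x|%:C <= `|x|.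
Proof.
have norm_i : `|'i| = 1 :> C.
  by rewrite normc_def /= expr0n expr1n add0r sqrtr1.
by have := normc_ge_Re (x * 'i); rewrite ReiNIm normrN normrM norm_i mulr1.
Qed.

Lemma Re_continuous : continuous (@complex.Re R : C^o -> R).
Proof.
move=> z A /nbhs_ballP[e /= e0 eA]; apply/nbhs_ballP.
exists (e%:C); first by rewrite /= ltcR.
move=> w /= zw; apply: eA; rewrite /ball /= -ltcR.
by apply: le_lt_trans zw; rewrite -raddfB; exact: normc_ge_Re.
Qed.

Lemma Im_continuous : continuous (@complex.Im R : C^o -> R).
Proof.
move=> z A /nbhs_ballP[e /= e0 eA]; apply/nbhs_ballP.
exists (e%:C); first by rewrite /= ltcR.
move=> w /= zw; apply: eA; rewrite /ball /= -ltcR.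
by apply: le_lt_trans zw; rewrite -raddfB; exact: normc_ge_Im.
Qed.

Lemma within_Re_continuous (T : topologicalType) (A : set T) (f : T -> C) :
  {within A, continuous (f : T -> C^o)} ->
  {within A, continuous (fun x => complex.Re (f x))}.
Proof. by apply: within_continuous_comp => x _; exact: Re_continuous. Qed.

Lemma within_Im_continuous (T : topologicalType) (A : set T) (f : T -> C) :
  {within A, continuous (f : T -> C^o)} ->
  {within A, continuous (fun x => complex.Im (f x))}.
Proof. by apply: within_continuous_comp => x _; exact: Im_continuous. Qed.

Lemma cvg_mx_coord (I : Type) (F : set_system I) (FF : Filter F) m n
    (f : I -> 'M[R]_(m, n)) (L : 'M[R]_(m, n)) :
  (forall i j, f x i j @[x --> F] --> L i j) -> f x @[x --> F] --> L.
Proof.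
move=> h A [P PM sPA].
apply: (@filterS _ F FF (fun x => forall i j, P i j (f x i j))).
  by move=> x Px; exact: sPA.
apply: filter_forall => i; apply: filter_forall => j.
exact: (h i j _ (PM i j)).
Qed.

Lemma mulmx_cvg (I : Type) (F : set_system I) (FF : Filter F) m n p
    (f : I -> 'M[R]_(m, n)) (g : I -> 'M[R]_(n, p))
    (A : 'M[R]_(m, n)) (B : 'M[R]_(n, p)) :
  f x @[x --> F] --> A -> g x @[x --> F] --> B ->
  f x *m g x @[x --> F] --> A *m B.
Proof.
move=> fA gB; apply: cvg_mx_coord => i j; rewrite mxE.
under eq_fun do rewrite mxE.
apply: cvg_big => [|k _]; first exact: add_continuous.
apply: cvgM.
- exact: (cvg_comp _ _ fA (@coord_continuous _ _ _ i k A)).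
- exact: (cvg_comp _ _ gB (@coord_continuous _ _ _ k j B)).
Qed.

Lemma mulmx_continuous m n p (g : 'M[R]_(m, n)) :
  continuous (fun h : 'M[R]_(n, p) => g *m h).
Proof.
move=> h.
exact: (@mulmx_cvg _ (nbhs h) _ _ _ _ (fun=> g) id g h (cvg_cst _) (@cvg_id _ _)).
Qed.

Lemma mulmxr_continuous m n p (g : 'M[R]_(n, p)) :
  continuous (fun h : 'M[R]_(m, n) => h *m g).
Proof.
move=> h.
exact: (@mulmx_cvg _ (nbhs h) _ _ _ _ id (fun=> g) h g (@cvg_id _ _) (cvg_cst _)).
Qed.

End Cont.

Section CContinuous.
Variables (R : realType) (T : topologicalType) (A : set T).
Local Notation C := R[i].

Lemma conjc_continuous : continuous (@conjc R : C^o -> C^o).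
Proof.
move=> z B /nbhs_ballP[e /= e0 eB]; apply/nbhs_ballP; exists e => // w /= zw.
by apply: eB; rewrite /ball /= -rmorphB normcJ.
Qed.

Lemma within_conjc_continuous (f : T -> C) :
  {within A, continuous (f : T -> C^o)} ->
  {within A, continuous ((fun x => (f x)^*) : T -> C^o)}.
Proof. by apply: within_continuous_comp => x _; exact: conjc_continuous. Qed.

Lemma within_mulc_continuous (f g : T -> C) :
  {within A, continuous (f : T -> C^o)} ->
  {within A, continuous (g : T -> C^o)} ->
  {within A, continuous ((fun x => f x * g x) : T -> C^o)}.
Proof. by move=> cf cg x; apply: cvgM; [exact: cf|exact: cg]. Qed.

Lemma within_addc_continuous (f g : T -> C) :
  {within A, continuous (f : T -> C^o)} ->
  {within A, continuous (g : T -> C^o)} ->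
  {within A, continuous ((fun x => f x + g x) : T -> C^o)}.
Proof. by move=> cf cg x; apply: cvgD; [exact: cf|exact: cg]. Qed.

Lemma within_cst_continuous (c : C) :
  {within A, continuous ((fun=> c) : T -> C^o)}.
Proof. by move=> x; exact: cvg_cst. Qed.

Lemma within_sumc_continuous (I : Type) (r : seq I) (f : I -> T -> C) :
  (forall i, {within A, continuous (f i : T -> C^o)}) ->
  {within A, continuous ((fun x => \sum_(i <- r) f i x) : T -> C^o)}.
Proof.
move=> cf; elim: r => [|i r IHr].
  by under eq_fun do rewrite big_nil; exact: within_cst_continuous.
under eq_fun do rewrite big_cons.
exact: (@within_addc_continuous (f i) (fun x => \sum_(k <- r) f k x) (cf i) IHr).
Qed.

End CContinuous.

(** * Borel and Haar measures of compact matrix groups *)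

Section Borel.
Variables (R : realType) (n : nat).
Local Notation mat := 'M[R]_n.+1.
Local Notation bor := (borel R n.+1).

Lemma borel_open (D : set mat) : open D -> measurable (D : set bor).
Proof. by move=> oD; exact: sub_sigma_algebra. Qed.

Lemma borel_closed (D : set mat) : closed D -> measurable (D : set bor).
Proof. by move=> /closed_openC/borel_open/measurableC; rewrite setCK. Qed.

Lemma borel_compact (D : set mat) : compact D -> measurable (D : set bor).
Proof. by move=> /(compact_closed (@norm_hausdorff _ _))/borel_closed. Qed.

Lemma within_continuous_measurable (D : set mat) (f : mat -> R) :
  measurable (D : set bor) -> {within D, continuous f} ->
  measurable_fun (D : set bor) f.
Proof.
move=> mD /continuousP cf; apply: (measurability _ (RGenOpens.measurableE R)).
move=> _ [_ [a [b ->] <-]].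
have : open (f @^-1` `]a, b[%classic : set (subspace D)).
  by apply: cf; exact: interval_open.
move=> /open_subspaceP[U oU UD].
rewrite setIC -UD; apply: measurableI => //; exact: borel_open.
Qed.

Lemma continuous_borel (f : mat -> mat) : continuous f ->
  measurable_fun [set: bor] (f : bor -> bor).
Proof.
move=> /continuousP cf; apply: (@measurability _ _ bor bor _ f (@open mat)) => //.
by move=> _ [B oB <-]; rewrite setTI; apply: borel_open; exact: cf.
Qed.

Lemma within_continuous_precomp (T : topologicalType) (D E : set mat)
    (f : mat -> T) (phi : mat -> mat) :
  continuous phi -> (forall x, D x -> E (phi x)) ->
  {within E, continuous f} -> {within D, continuous (f \o phi)}.
Proof.
move=> cphi DE /subspace_continuousP cf; apply/subspace_continuousP => x Dx.
apply: cvg_comp (cf _ (DE _ Dx)) => A EA.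
apply: (@filterS _ (nbhs x) _ _ _ _ (cphi x _ EA)) => y /= h Dy.
by apply: h; exact: DE.
Qed.

Lemma within_continuous_bounded (D : set mat) (f : mat -> R) :
  compact D -> {within D, continuous f} ->
  exists2 c : R, 0 <= c & forall x, D x -> `|f x| <= c.
Proof.
move=> cD cf; have /compact_bounded[M [_ MD]] := continuous_compact cf cD.
exists (`|M| + 1); first by rewrite addr_ge0.
by move=> x Dx; apply: MD; [rewrite ltr_pwDr// ler_norm|exists x].
Qed.

Lemma within_continuous_integrable (mu : probability bor R) (D : set mat)
    (f : mat -> R) :
  compact D -> {within D, continuous f} ->
  mu.-integrable (D : set bor) (EFin \o f).
Proof.
move=> cD cf; have mD := borel_compact cD.
apply: measurable_bounded_integrable => //.
- by apply: le_lt_trans (probability_le1 mu mD) _; rewrite ltry.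
- exact: within_continuous_measurable.
have [c _ fc] := within_continuous_bounded cD cf.
exists c; split; first exact: num_real.
by move=> y cy x Dx; apply: le_trans (fc x Dx) (ltW cy).
Qed.

Variables (S : set mat) (mu : probability bor R).
Hypotheses (cS : compact S) (gS : subgroup S [set g | g \in unitmx])
  (hmu : haar_probability S mu).

Lemma preimage_translate (g : mat) (B : set mat) : g \in unitmx ->
  (fun h => g *m h) @^-1` B = (fun h => invmx g *m h) @` B.
Proof.
move=> ug; apply/seteqP; split=> [h /= gB|_ [h Bh <-]] /=.
  by exists (g *m h) => //; rewrite mulKmx.
by rewrite mulKVmx.
Qed.

Lemma preimage_translate_subgroup (g : mat) : S g -> (fun h => g *m h) @^-1` S = S.
Proof.
have [Su _ SM SV] := gS; move=> Sg; apply/seteqP; split=> h /= Sh; last exact: SM.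
by rewrite -(mulKmx (Su _ Sg) h); apply: SM => //; exact: SV.
Qed.

(** [haar_probability] speaks of images of Borel sets under translation,
    whereas pushing a measure forward involves preimages; the two are exchanged
    by inverting [g]. *)
Lemma haar_preimage (g : mat) (B : set bor) : S g -> measurable B ->
  mu ((fun h : mat => g *m h) @^-1` B) = mu B.
Proof.
have [Su _ _ SV] := gS; move=> Sg mB; rewrite preimage_translate; last exact: Su.
by apply: hmu.2 => //; exact: SV.
Qed.

(** Translation by [g] pushes [mu] forward to itself and preserves [S], so
    that this is a change of variables. *)
Lemma haar_Rintegral (g : mat) (f : mat -> R) : S g ->
  {within S, continuous f} ->
  \int[mu]_(h in (S : set bor)) f (g *m h) = \int[mu]_(h in (S : set bor)) f h.
Proof.
move=> Sg cf; have mS := borel_compact cS.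
have mphi := continuous_borel (@mulmx_continuous R _ _ n.+1 g).
(* The change of variables requires a function measurable on all matrices, and
   [f] is controlled on [S] only: extend it by zero. *)
pose fS : bor -> \bar R := EFin \o (f \_ S).
have mfS : measurable_fun [set: bor] (EFin \o (f \_ S) : bor -> \bar R).
  apply/measurable_EFinP/(measurable_restrictT _ mS).
  exact: within_continuous_measurable.
have SgE : (fun h : bor => g *m h : bor) @^-1` (S : set bor) = S :=
  preimage_translate_subgroup Sg.
have fgS : mu.-integrable (S : set bor) (fun h : bor => fS (g *m h)).
  have SM h : S h -> S (g *m h) by rewrite -{1}(preimage_translate_subgroup Sg).
  have := within_continuous_integrable mu cS
    (within_continuous_precomp (@mulmx_continuous R _ _ _ g) SM cf).
  apply: eq_integrable => // x; rewrite inE => Sx.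
  by rewrite /fS /= patchE mem_set //; exact: SM.
congr fine.
transitivity (\int[mu]_(h in (S : set bor)) fS (g *m h))%E.
  apply: eq_integral => h; rewrite inE => Sh; rewrite /fS /= patchE mem_set //.
  by rewrite -(preimage_translate_subgroup Sg) in Sh.
transitivity (\int[mu]_(h in (S : set bor)) fS h)%E; last first.
  by apply: eq_integral => h hS; rewrite /fS /= patchE hS.
transitivity (\int[pushforward mu (fun h : bor => g *m h : bor)]_
  (h in (S : set bor)) fS h)%E.
  by rewrite (integral_pushforward mphi mfS) ?SgE.
by apply: eq_measure_integral => A mA _; exact: haar_preimage.
Qed.

(** If [S `&` O] were contained in [N], it would be null, and so would all its
    translates.  By compactness finitely many of them cover [S], which has
    mass 1. *)
Lemma haar_charges_nbhs1 (N : set bor) (O : set mat) :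
  mu.-negligible N -> open O -> O 1%:M -> exists k : mat, [/\ S k, O k & ~ N k].
Proof.
move=> negN oO O1; apply: contrapT => noK.
have [Su S1 SM SV] := gS.
have mS := borel_compact cS; have mO := borel_open oO.
have SO_N : (S `&` O : set bor) `<=` N.
  by move=> k [Sk Ok]; apply: contrapT => Nk; apply: noK; exists k.
have SO0 : mu (S `&` O : set bor) = 0%E.
  by apply/negligibleP; [exact: measurableI|exact: negligibleS negN].
pose tr (g : mat) : set mat := (fun h => invmx g *m h) @^-1` O.
have trO g : open (tr g).
  by have /continuousP := @mulmx_continuous R _ _ n.+1 (invmx g); exact.
have cover_S : S `<=` cover S tr.
  by move=> g Sg; exists g => //; rewrite /tr /= mulVmx //; exact: Su.
have := cS; rewrite compact_cover => /(_ _ S tr (fun g _ => trO g) cover_S).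
move=> [D' D'S SD'].
have neg : mu.-negligible (S : set bor).
  apply: (@negligibleS _ _ _ mu (\bigcup_(g in [set` D']) (S `&` tr g))).
    by move=> h Sh; have [g Dg gh] := SD' h Sh; exists g.
  rewrite bigcup_fset big_seq; elim/big_ind: _ => [|A B nA nB|g gD'].
  - exact: negligible_set0.
  - exact: negligibleU.
  have Sg : S g by have := D'S _ gD'; rewrite inE.
  have SVg := SV _ Sg.
  have -> : S `&` tr g = (fun h => invmx g *m h) @^-1` (S `&` O).
    by rewrite preimage_setI (preimage_translate_subgroup SVg).
  have mSO : measurable (S `&` O : set bor) by exact: measurableI.
  have mtr := continuous_borel (@mulmx_continuous R _ _ n.+1 (invmx g)).
  have mpre : measurable ((fun h : bor => invmx g *m h : bor) @^-1`
      (S `&` O : set bor)).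
    by rewrite -[X in measurable X]setTI; exact: (mtr measurableT _ mSO).
  apply/negligibleP => //; rewrite -SO0.
  exact: (haar_preimage SVg mSO).
have : mu S = 0%E by apply/negligibleP.
by rewrite hmu.1 => /eqP; rewrite onee_eq0.
Qed.

(** This is how a property that passes to limits is carried from almost every
    point of [S] to the identity; a sequence is needed, rather than a filter, for
    the convergence theorems of integration to apply. *)
Lemma haar_ae_seq1 (P : mat -> Prop) :
  {ae mu, forall k : bor, S k -> P k} ->
  exists2 u : nat -> mat, (forall j, S (u j) /\ P (u j)) & u @ \oo --> (1%:M : mat).
Proof.
move=> [N [mN N0 PN]].
have negN : mu.-negligible N by apply/negligibleP.
have h (j : nat) : exists k : mat, [/\ S k, P k & ball (1%:M : mat) j.+1%:R^-1 k].
  have j0 : 0 < j.+1%:R^-1 :> R by rewrite invr_gt0.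
  have [k [Sk Ok Nk]] := haar_charges_nbhs1 negN
    (@open_interior _ (ball (1%:M : mat) j.+1%:R^-1))
    (nbhsx_ballx _ _ j0).
  exists k; split => //; last exact: interior_subset Ok.
  by apply: contrapT => nP; apply: Nk; apply: PN => /(_ Sk).
have [u uP] := choice h; exists u; first by move=> j; have [] := uP j.
apply/cvg_ballP => e e0; near=> j.
have [_ _] := uP j; apply: le_ball; apply: ltW; near: j.
exact: (near_infty_natSinv_lt (PosNum e0)).
Unshelve. all: by end_near. Qed.

End Borel.

(** * Integrals of complex-valued functions over a compact set *)

Section CIntegral.
Variables (R : realType) (d : nat).
Local Notation C := R[i].
Local Notation mat := 'M[R]_d.+2.
Local Notation bor := (borel R d.+2).
Variables (S : set mat) (mu : probability bor R).
Hypothesis cS : compact S.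

Local Notation ccont f := {within S, continuous (f : mat -> C^o)}.

Lemma eq_Cintegral (f g : mat -> C) : (forall x, S x -> f x = g x) ->
  Cintegral mu S f = Cintegral mu S g.
Proof.
by move=> fg; rewrite /Cintegral; congr (_ +i* _);
  apply: eq_Rintegral => x; rewrite inE => Sx; rewrite fg.
Qed.

Lemma integrable_Re (f : mat -> C) : ccont f ->
  mu.-integrable (S : set bor) (EFin \o (fun x => complex.Re (f x))).
Proof. by move=> /within_Re_continuous; exact: within_continuous_integrable. Qed.

Lemma integrable_Im (f : mat -> C) : ccont f ->
  mu.-integrable (S : set bor) (EFin \o (fun x => complex.Im (f x))).
Proof. by move=> /within_Im_continuous; exact: within_continuous_integrable. Qed.

Lemma CintegralD (f g : mat -> C) : ccont f -> ccont g ->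
  Cintegral mu S (fun x => f x + g x) = Cintegral mu S f + Cintegral mu S g.
Proof.
move=> cf cg; have mS := borel_compact cS; rewrite /Cintegral.
under eq_Rintegral do rewrite raddfD.
under [in X in _ +i* X]eq_Rintegral do rewrite raddfD.
rewrite !RintegralD //; by [exact: integrable_Re|exact: integrable_Im].
Qed.

Lemma CintegralZ (c : C) (f : mat -> C) : ccont f ->
  Cintegral mu S (fun x => c * f x) = c * Cintegral mu S f.
Proof.
move=> cf; have mS := borel_compact cS.
have iR := integrable_Re cf; have iI := integrable_Im cf.
have ReM (z w : C) : complex.Re (z * w) =
  complex.Re z * complex.Re w - complex.Im z * complex.Im w by case: z w => ? ? [].
have ImM (z w : C) : complex.Im (z * w) =
  complex.Re z * complex.Im w + complex.Im z * complex.Re w by case: z w => ? ? [].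
have int (r : R) (h : mat -> R) : mu.-integrable (S : set bor) (EFin \o h) ->
  mu.-integrable (S : set bor) (EFin \o (fun x => r * h x)).
  move=> ih; exact: (integrableZl mS r ih).
apply/eqP; rewrite eq_complex ReM ImM /Cintegral /=; apply/andP; split; apply/eqP.
  under eq_Rintegral do rewrite ReM.
  by rewrite RintegralB ?RintegralZl //; exact: int.
under eq_Rintegral do rewrite ImM.
by rewrite RintegralD ?RintegralZl //; exact: int.
Qed.

Lemma Cintegral0 : Cintegral mu S (fun=> 0) = 0.
Proof.
rewrite -{2}(mul0r (Cintegral mu S (fun=> 0))) -CintegralZ; last first.
  exact: within_cst_continuous.
by apply: eq_Cintegral => x _; rewrite mul0r.
Qed.

Lemma Cintegral_sum (I : Type) (r : seq I) (f : I -> mat -> C) :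
  (forall i, ccont (f i)) ->
  Cintegral mu S (fun x => \sum_(i <- r) f i x) = \sum_(i <- r) Cintegral mu S (f i).
Proof.
move=> cf; elim: r => [|i r IHr].
  rewrite big_nil -[RHS]Cintegral0.
  by apply: eq_Cintegral => x _; rewrite big_nil.
rewrite big_cons -IHr -CintegralD //; last exact: within_sumc_continuous.
by apply: eq_Cintegral => x _; rewrite big_cons.
Qed.

Lemma Cintegral_conj (f : mat -> C) : ccont f ->
  Cintegral mu S (fun x => (f x)^*) = (Cintegral mu S f)^*.
Proof.
move=> cf; have mS := borel_compact cS.
rewrite /Cintegral /=; congr (_ +i* _).
  by apply: eq_Rintegral => x _; case: (f x).
rewrite -mulN1r -RintegralZl //; last exact: integrable_Im.
by apply: eq_Rintegral => x _; case: (f x) => a b /=; rewrite mulN1r.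
Qed.

Lemma within_continuous_boundedc (f : mat -> C) : ccont f ->
  exists2 c : R, 0 <= c & forall x, S x -> `|f x| <= c%:C.
Proof.
move=> cf.
have [a a0 fa] := within_continuous_bounded cS (within_Re_continuous cf).
have [b b0 fb] := within_continuous_bounded cS (within_Im_continuous cf).
exists (a + b); first exact: addr_ge0.
have normR (r : R) : `|r%:C| = `|r|%:C.
  by rewrite normc_def /= expr0n addr0 sqrtr_sqr.
move=> x Sx; rewrite [f x]complexE rmorphD; apply: le_trans (ler_normD _ _) _.
apply: lerD; first by rewrite normR lecR; exact: fa.
by rewrite normrM normc_def /= expr0n expr1n add0r sqrtr1 mul1r normR lecR; exact: fb.
Qed.

Lemma bounded_Rintegral_cvg (f_ : nat -> mat -> R) (f : mat -> R) (c : R) :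
  (forall j, {within S, continuous (f_ j)}) -> {within S, continuous f} ->
  (forall j x, S x -> `|f_ j x| <= c) ->
  (forall x, S x -> f_ j x @[j --> \oo] --> f x) ->
  \int[mu]_(x in (S : set bor)) f_ j x @[j --> \oo] -->
  \int[mu]_(x in (S : set bor)) f x.
Proof.
move=> cf_ cf fc f_f; have mS := borel_compact cS.
have mE (h : mat -> R) : {within S, continuous h} ->
    measurable_fun (S : set bor) (EFin \o h : bor -> \bar R).
  by move=> ch; apply/measurable_EFinP; exact: within_continuous_measurable.
have ic : mu.-integrable (S : set bor) (fun=> c%:E).
  exact: (@within_continuous_integrable _ _ mu S (fun=> c) cS (fun=> cvg_cst _)).
have fE x : S x -> (f_ j x)%:E @[j --> \oo] --> (f x)%:E.
  by move=> Sx; apply: cvg_EFin; [exact: nearW|exact: f_f].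
have [_ _] := @dominated_convergence _ bor R mu S mS
  (fun j x => (f_ j x)%:E) (fun x => (f x)%:E) (fun=> c%:E)
  (fun j => mE _ (cf_ j)) (mE _ cf)
  (aeW mu fE) ic
  (aeW mu (fun x j Sx => fc j x Sx)).
have <- : (\int[mu]_(x in (S : set bor)) f x)%:E =
    (\int[mu]_(x in (S : set bor)) (f x)%:E)%E.
  by apply: fineK; apply: integrable_fin_num => //; exact: within_continuous_integrable.
by move/fine_cvg.
Qed.

(** The limit [l] of the integrals is a datum because in the application these
    integrals are values of a continuous function along a sequence: the lemma
    transports an integral equation to the limit point. *)
Lemma bounded_Cintegral_cvg (f_ : nat -> mat -> C) (f : mat -> C) (c : R) :
  (forall j, ccont (f_ j)) -> ccont f ->
  (forall j x, S x -> `|f_ j x| <= c%:C) ->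
  (forall x, S x -> f_ j x @[j --> \oo] --> (f x : C^o)) ->
  forall l : C, (Cintegral mu S (f_ j) @[j --> \oo] --> (l : C^o)) ->
  Cintegral mu S f = l.
Proof.
move=> cf_ cf fc f_f l Il.
have cvgR := cvg_comp _ _ Il (@Re_continuous R l).
have cvgI := cvg_comp _ _ Il (@Im_continuous R l).
have le_trans_complex (r r' : R) (z : C) : r%:C <= z -> z <= r'%:C -> r <= r'.
  by move=> rz zr; rewrite -lecR (le_trans rz zr).
have intR := @bounded_Rintegral_cvg (fun j x => complex.Re (f_ j x))
  (fun x => complex.Re (f x)) c (fun j => within_Re_continuous (cf_ j))
  (within_Re_continuous cf)
  (fun j x Sx => le_trans_complex _ _ _ (normc_ge_Re (f_ j x)) (fc j x Sx))
  (fun x Sx => cvg_comp _ _ (f_f x Sx) (@Re_continuous R (f x))).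
have intI := @bounded_Rintegral_cvg (fun j x => complex.Im (f_ j x))
  (fun x => complex.Im (f x)) c (fun j => within_Im_continuous (cf_ j))
  (within_Im_continuous cf)
  (fun j x Sx => le_trans_complex _ _ _ (normc_ge_Im (f_ j x)) (fc j x Sx))
  (fun x Sx => cvg_comp _ _ (f_f x Sx) (@Im_continuous R (f x))).
apply/eqP; rewrite eq_complex; apply/andP; split; apply/eqP.
  exact: (@cvg_unique _ (@norm_hausdorff _ R^o) _ _ _ _ intR cvgR).
exact: (@cvg_unique _ (@norm_hausdorff _ R^o) _ _ _ _ intI cvgI).
Qed.

End CIntegral.

(** * Means of irreducible representations *)

Section HaarRep.
Variables (R : realType) (d : nat).
Local Notation C := R[i].
Local Notation mat := 'M[R]_d.+2.
Variables (S : set mat) (mu : probability (borel R d.+2) R).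
Hypotheses (cS : compact S) (gS : subgroup S [set g | g \in unitmx])
  (hmu : haar_probability S mu).

Lemma haar_Cintegral (g : mat) (f : mat -> C) : S g ->
  {within S, continuous (f : mat -> C^o)} ->
  Cintegral mu S (fun h => f (g *m h)) = Cintegral mu S f.
Proof.
move=> Sg cf; rewrite /Cintegral; congr (_ +i* _).
  exact: (haar_Rintegral cS gS hmu Sg (within_Re_continuous cf)).
exact: (haar_Rintegral cS gS hmu Sg (within_Im_continuous cf)).
Qed.

(** The matrix [P] of the means of the coefficients satisfies
    [rho g *m P = P], by invariance of [mu].  Its column space consists of fixed
    vectors; being invariant, it is zero or everything, and in the second case
    [rho] is trivial. *)
Lemma irreducible_Cintegral_eq0 n (rho : mat -> 'M[C]_n) :
  irreducible_unitary S rho -> ~ trivial_on S rho ->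
  forall i j, Cintegral mu S (fun g => rho g i j) = 0.
Proof.
move=> [_ rhoM _ crho irr] ntriv.
pose P := \matrix_(i, j) Cintegral mu S (fun g => rho g i j).
have fixP g : S g -> rho g *m P = P.
  move=> Sg; apply/matrixP => i j; rewrite !mxE.
  rewrite -[RHS](haar_Cintegral Sg (crho i j)).
  under eq_bigr do rewrite mxE -(CintegralZ mu cS _ (crho _ _)).
  rewrite -Cintegral_sum //; last first.
    move=> k; apply: within_mulc_continuous; last exact: crho.
    exact: within_cst_continuous.
  by apply: eq_Cintegral => h Sh; rewrite rhoM // mxE.
(* [irreducible_unitary] encodes a subspace by a row space, hence the
   transpose. *)
have [|P0|Pfull] := irr P^T.
- by move=> g Sg; rewrite -trmx_mul fixP.
- by move=> i j; have /matrixP/(_ j i) := P0; rewrite !mxE.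
case: ntriv => g Sg.
have uP : P \in unitmx by rewrite -unitmx_tr -row_full_unit.
by rewrite -[rho g](mulmxK uP) fixP // mulmxV.
Qed.

Lemma conj_chi_rep_continuous n (rho : mat -> 'M[C]_n) :
  irreducible_unitary S rho ->
  {within S, continuous ((fun g => (chi_rep rho g)^*) : mat -> C^o)}.
Proof.
move=> [_ _ _ crho _]; apply: within_conjc_continuous.
apply: within_mulc_continuous; first exact: within_cst_continuous.
exact: within_sumc_continuous.
Qed.

Lemma Cintegral_conj_chi_eq0 n (rho : mat -> 'M[C]_n) :
  irreducible_unitary S rho -> ~ trivial_on S rho ->
  Cintegral mu S (fun g => (chi_rep rho g)^*) = 0.
Proof.
move=> irr ntriv; have [_ _ _ crho _] := irr.
have ctr : {within S, continuous ((fun g => \tr (rho g)) : mat -> C^o)}.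
  exact: within_sumc_continuous.
have cchi : {within S, continuous (chi_rep rho : mat -> C^o)}.
  exact: (@within_mulc_continuous R _ S (fun=> n%:R) (fun g => \tr (rho g))
    (@within_cst_continuous R _ S n%:R) ctr).
rewrite (@Cintegral_conj _ _ S mu cS (chi_rep rho) cchi).
rewrite (@CintegralZ _ _ S mu cS n%:R (fun g => \tr (rho g)) ctr).
rewrite (@Cintegral_sum _ _ S mu cS _ _ (fun i g => rho g i i) (fun i => crho i i)).
rewrite big1 ?mulr0 ?rmorph0 // => i _.
exact: irreducible_Cintegral_eq0.
Qed.

End HaarRep.

(** * The groups K and M and the translation action of K *)

Section Iwasawa.
Variables (R : realType) (d : nat) (X : iwasawa_data R d).
Local Notation C := R[i].
Local Notation mat := 'M[R]_d.+2.
Local Notation G := (SO1o R d.+1).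
Local Notation K := (Kgrp X).
Local Notation M := (Mgrp X).

Lemma SO1o_1 : G 1%:M.
Proof.
apply: connected_component_refl; split; last exact: det1.
by rewrite trmx1 mul1mx mulmx1.
Qed.

Lemma SO1o_unit (g : mat) : G g -> g \in unitmx.
Proof.
by move=> /connected_component_sub[_ dg]; rewrite unitmxE dg unitr1.
Qed.

Lemma K_compact : compact K.
Proof. by have [] := Kgrp_max X. Qed.

Lemma K_subgroup : subgroup K [set g | g \in unitmx].
Proof.
have [[KG K1 KM KV] _ _] := Kgrp_max X; split => //.
by move=> g /KG/SO1o_unit.
Qed.

Lemma M_sub_K : M `<=` K.
Proof. by move=> m []. Qed.

Lemma M_subgroup : subgroup M [set g | g \in unitmx].
Proof.
have [Ku K1 KM KV] := K_subgroup; split.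
- by move=> m /M_sub_K/Ku.
- by split => // t; rewrite mul1mx mulmx1.
- move=> m m' [Km cm] [Km' cm']; split; first exact: KM.
  by move=> t; rewrite -mulmxA cm' !mulmxA cm.
- move=> m [Km cm]; split; first exact: KV.
  move=> t; have um : m \in unitmx := Ku _ Km.
  by rewrite -{1}[aflow X t](mulmxK um) -cm !mulmxA mulVmx // mul1mx.
Qed.

(** The centralizer is cut out of the compact group [K] by the closed conditions
    [k *m aflow X t - aflow X t *m k = 0]. *)
Lemma M_compact : compact M.
Proof.
have -> : M = K `&` \bigcap_(t in setT)
    ((fun k : mat => k *m aflow X t - aflow X t *m k) @^-1` [set 0]).
  apply/seteqP; split=> k [Kk ck]; split => //.
    by move=> t _ /=; rewrite ck subrr.
  by move=> t; apply/subr0_eq; exact: (ck t I).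
apply: compact_closedI; first exact: K_compact.
apply: closed_bigI => t _.
apply: preimage_closed => [k _|]; last first.
  by apply: compact_closed; [exact: norm_hausdorff|exact: compact_set1].
exact: (cvgB (@mulmxr_continuous R _ _ _ (aflow X t) k)
  (@mulmx_continuous R _ _ _ (aflow X t) k)).
Qed.

Lemma aflow0 : aflow X 0 = 1%:M.
Proof.
have [aG aD _ _] := aflow_diag X.
have u0 : aflow X 0 \in unitmx by apply: SO1o_unit; exact: aG.
by rewrite -[LHS](mulmxK u0) -aD addr0 mulmxV.
Qed.

Lemma horospherical1 : horospherical (aflow X) G 1%:M.
Proof.
have [_ aD _ _] := aflow_diag X; split; first exact: SO1o_1.
under eq_fun do rewrite mulmx1 -aD addNr aflow0.
exact: cvg_cst.
Qed.

(** [k = k *m aflow X 0 *m 1%:M] is an Iwasawa decomposition. *)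
Lemma iwasawa_K (k : mat) : K k -> kappa X k = k /\ Hproj X k = 0.
Proof.
by move=> Kk; have := iwasawa_unique 0 Kk horospherical1; rewrite aflow0 !mulmx1.
Qed.

Lemma cexp0 : cexp 0 = 1 :> C.
Proof. by rewrite /cexp /= expR0 cos0 sin0 mulr1. Qed.

(** The exponential factor of [U] disappears on [K] because [Hproj] vanishes
    there. *)
Lemma U_K (s : C) (k x : mat) (v : mat -> C) : K k -> K x ->
  U X s k v x = v (invmx k *m x).
Proof.
move=> Kk Kx; have [_ _ KM KV] := K_subgroup.
have [kE HE] := iwasawa_K (KM _ _ (KV _ Kk) Kx).
by rewrite /U kE HE mulr0 oppr0 cexp0 mul1r.
Qed.

(** Invariance under [invmx m], evaluated at the identity. *)
Lemma Minvariant_cst (s : C) (v : mat -> C) : Minvariant X s v ->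
  forall m, M m -> v m = v 1%:M.
Proof.
move=> vM m Mm; have [_ M1 _ MV] := M_subgroup.
have MVm := MV _ Mm.
by rewrite -(vM _ MVm _ (M_sub_K M1)) U_K ?invmxK ?mulmx1 //; exact: M_sub_K.
Qed.

(** The equation defining [L2K_type] holds at almost every point of [K] only.
    Take points [u j] tending to the identity at which it holds:
    [v (u j)] tends to [v 1%:M] by continuity, and the integrals converge because
    [v] is continuous, hence bounded, on the compact group [K]. *)
Lemma L2K_type_at1 n (ups : mat -> 'M[C]_n) (v : mat -> C) :
  irreducible_unitary M ups -> L2K_type X ups v ->
  {within K, continuous (v : mat -> C^o)} ->
  Cintegral (muM X) M (fun m => (chi_rep ups m)^* * v m) = v 1%:M.
Proof.
move=> irr [_ v_ae] cv; have [_ K1 KM _] := K_subgroup.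
have [u uP u1] := haar_ae_seq1 K_compact K_subgroup (muK_haar X) v_ae.
have Ku j : K (u j) := (uP j).1.
have vw x : K x -> v @ within K (nbhs x) --> (v x : C^o).
  by move: cv => /subspace_continuousP; exact.
have uvP x : K x -> v (u j *m x) @[j --> \oo] --> (v x : C^o).
  move=> Kx.
  have ux : u j *m x @[j --> \oo] --> x.
    rewrite -[X in _ --> X]mul1mx.
    exact: (@mulmx_cvg R _ \oo _ _ _ _ u (fun=> x) _ _ u1 (cvg_cst _)).
  apply: cvg_comp (vw x Kx) => B KB.
  apply: (@filterS _ \oo _ _ _ _ (ux _ KB)) => j /= KBj.
  by apply: KBj; apply: KM.
have cchi := conj_chi_rep_continuous irr.
have cvu j : {within M, continuous ((fun m => v (u j *m m)) : mat -> C^o)}.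
  apply: (within_continuous_precomp (@mulmx_continuous R _ _ _ (u j)) _ cv) => m Mm.
  by apply: KM => //; exact: M_sub_K.
have [a a0 chia] := within_continuous_boundedc M_compact cchi.
have [b b0 vb] := within_continuous_boundedc K_compact cv.
have cv_M : {within M, continuous (v : mat -> C^o)}.
  by have := within_continuous_precomp (phi := id) (fun=> cvg_id) M_sub_K cv.
have cprod j := within_mulc_continuous cchi (cvu j).
have cprod1 := within_mulc_continuous cchi cv_M.
have prod_le j m : M m -> `|(chi_rep ups m)^* * v (u j *m m)| <= (a * b)%:C.
  move=> Mm; have -> : (a * b)%:C = a%:C * b%:C by rewrite rmorphM.
  rewrite normrM; apply: ler_pM => //; first exact: chia.
  by apply: vb; apply: KM => //; exact: M_sub_K.
have prod_cvg m : M m -> (chi_rep ups m)^* * v (u j *m m) @[j --> \oo] -->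
    ((chi_rep ups m)^* * v m : C^o).
  by move=> Mm; apply: cvgM; [exact: cvg_cst|apply: uvP; exact: M_sub_K].
have Iu : Cintegral (muM X) M (fun m => (chi_rep ups m)^* * v (u j *m m))
    @[j --> \oo] --> (v 1%:M : C^o).
  under eq_fun do rewrite (uP _).2 -[u _]mulmx1.
  exact: uvP.
exact: (bounded_Cintegral_cvg M_compact cprod cprod1 prod_le prod_cvg Iu).
Qed.

End Iwasawa.

(** * Vanishing of the operator on M-invariant vectors *)

Theorem corollary3p6 (R : realType) (d : nat) (hd : (1 <= d)%N)
  (X : iwasawa_data R d)
  (n : nat) (ups : 'M[R]_(d.+2) -> 'M[R[i]]_n) (s : R)
  (V : set ('M[R]_(d.+2) -> R[i]))
  (hV : complementary_series X ups s V)
  (hups : ~ trivial_on (Mgrp X) ups)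
  (p1 p2 : nat)
  (tau1 : 'M[R]_(d.+2) -> 'M[R[i]]_p1) (tau2 : 'M[R]_(d.+2) -> 'M[R[i]]_p2)
  (htau1 : Ktype X s%:C V tau1) (htau2 : Ktype X s%:C V tau2)
  (e : 'I_p2 -> 'M[R]_(d.+2) -> R[i])
  (he : orthonormal_basis X e (isotypic X s%:C V tau2))
  (v : 'M[R]_(d.+2) -> R[i])
  (hv : isotypic X s%:C V tau1 v) (hvM : Minvariant X s%:C v) :
  forall k, Kgrp X k -> Top X s%:C e v k = 0.
Proof.
move=> k Kk.
have [irr _ [_ VL2 _] _ _] := hV; have [cv Vv _] := hv.
have vcst := Minvariant_cst hvM.
have v1 : v 1%:M = 0.
  rewrite -(L2K_type_at1 irr (VL2 _ Vv) cv).
  have cchi := conj_chi_rep_continuous irr.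
  transitivity (Cintegral (muM X) (Mgrp X)
    (fun m => v 1%:M * (chi_rep ups m)^*)).
    by apply: eq_Cintegral => m Mm; rewrite vcst // mulrC.
  rewrite (CintegralZ _ (@M_compact _ _ X)) //.
  rewrite (Cintegral_conj_chi_eq0 (@M_compact _ _ X) (M_subgroup X) (muM_haar X)) //.
  by rewrite mulr0.
rewrite /Top -[RHS](Cintegral0 (muM X) (@M_compact _ _ X)).
by apply: eq_Cintegral => m Mm; rewrite vcst // v1 mul0r.
Qed.
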